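(* Let $\mathbb{F}_q$ be a finite field with $q$ elements. For any positive integer $n$, the generating function $h_n(t) = 1+\sum_{k=1}^{\infty} c_{n,k}(q)\,t^k$ is a rational function of $t$.
   Context: For $n,k\geq 1$, $M_n(\mathbb{F}_q)^{(k)}$ is the set of $k$-tuples of pairwise commuting $n\times n$ matrices over $\mathbb{F}_q$. $GL_n(\mathbb{F}_q)$ acts on it by simultaneous conjugation, $g\cdot(A_1,\ldots,A_k) = (gA_1g^{-1},\ldots,gA_kg^{-1})$, and $c_{n,k}(q)$ is the number of orbits (simultaneous similarity classes). That a formal power series is a rational function means that it is the power series expansion of a quotient of two polynomials in $t$. *)

(* Defs.v *)
From HB Require Import structures.
From mathcomp Require Import all_boot all_order all_algebra.

Set Implicit Arguments.
Unset Strict Implicit.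
Unset Printing Implicit Defensive.

Import GRing.Theory.
Local Open Scope ring_scope.

Definition commuting_tuples (F : finFieldType) (n k : nat) :
    {set k.-tuple 'M[F]_n} :=
  [set A : k.-tuple 'M[F]_n | all2rel (@comm_mxb F n) A].

Definition simconj (F : finFieldType) (n k : nat) (g : 'M[F]_n)
    (A : k.-tuple 'M[F]_n) : k.-tuple 'M[F]_n :=
  [tuple of [seq g *m M *m invmx g | M <- A]].

(* GL_n(F) is taken as the set unitmx of invertible matrices: the library's
   {'GL_n[F]} consists of matrices of size n.-1.+1, not n. *)
Definition simorbit (F : finFieldType) (n k : nat)
    (A : k.-tuple 'M[F]_n) : {set k.-tuple 'M[F]_n} :=
  [set simconj g A | g : 'M[F]_n & g \in unitmx].

Definition num_sim_classes (F : finFieldType) (n k : nat) : nat :=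
  #|[set simorbit A | A in commuting_tuples F n k]|.

(* A formal power series over K is given by its sequence of coefficients. *)
Definition class_series (F : finFieldType) (n : nat) : nat -> rat :=
  fun k => if k == 0%N then 1 else (num_sim_classes F n k)%:R.

(* Since Q`_0 != 0, Q is invertible in K[[t]], and the condition says that
   Q * h = P there (Cauchy product), i.e. h is the expansion of P / Q at 0. *)
Definition expansion_of_quotient (K : fieldType) (h : nat -> K)
    (P Q : {poly K}) : Prop :=
  Q`_0 != 0 /\ forall m : nat, \sum_(i < m.+1) Q`_i * h (m - i)%N = P`_m.

Definition rational_series (K : fieldType) (h : nat -> K) : Prop :=
  exists P Q : {poly K}, expansion_of_quotient h P Q.

(* Main.v *)
(** The similarity class of a tuple has a size that depends only on the set S of
    its entries, so c_(n,k) is a combination, with coefficients independent of k,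
    of the numbers s_S(k) of k-tuples whose set of entries is exactly S, where S
    runs over the finitely many commuting subsets of M_n(F_q).  Since the s_T(k)
    for T inside S add up to |S|^k, induction on |S| shows that each generating
    function sum_k s_S(k) t^k is a combination of geometric series. *)
Require Import Defs.
From mathcomp Require Import all_boot all_order all_algebra.

Set Implicit Arguments.
Unset Strict Implicit.
Unset Printing Implicit Defensive.

Import GRing.Theory Num.Theory.
Local Open Scope ring_scope.

Section RationalSeries.

Variable K : fieldType.
Implicit Types (h : nat -> K) (P Q R : {poly K}).

Lemma eq_rational_series h1 h2 :
  h1 =1 h2 -> rational_series h1 -> rational_series h2.
Proof.
move=> eqh [P [Q [Q0 hPQ]]]; exists P, Q; split=> // m.
by rewrite -hPQ; apply: eq_bigr => i _; rewrite eqh.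
Qed.

(** Expanding a fraction by [R] leaves its series unchanged; this brings two quotients to a common
    denominator. *)
Lemma expansion_of_quotientM h P Q R :
    R`_0 != 0 -> expansion_of_quotient h P Q ->
  expansion_of_quotient h (R * P) (R * Q).
Proof.
move=> R0 [Q0 hPQ]; split; first by rewrite coef0M mulf_neq0.
(* Coefficients up to degree m involve only [h 0], ..., [h m], so [h] may be truncated to a
   polynomial, and associativity of polynomial multiplication applies. *)
move=> m; pose H := \poly_(i < m.+1) h i.
have convH (p : {poly K}) j : (j <= m)%N ->
    \sum_(i < j.+1) p`_i * h (j - i)%N = (p * H)`_j.
  move=> jm; rewrite coefM; apply: eq_bigr => i _; rewrite coef_poly.
  by rewrite ltnS (leq_trans (leq_subr _ _) jm).
rewrite convH // -mulrA !coefM; apply: eq_bigr => i _.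
by rewrite -convH ?leq_subr // hPQ.
Qed.

Lemma rational_seriesD h1 h2 :
    rational_series h1 -> rational_series h2 ->
  rational_series (fun k => h1 k + h2 k).
Proof.
move=> [P1 [Q1 e1]] [P2 [Q2 e2]].
have [Q10 Q20] := (e1.1, e2.1).
have [Q0 f1] := expansion_of_quotientM Q20 e1.
have [_ f2] := expansion_of_quotientM Q10 e2.
exists (Q2 * P1 + Q1 * P2), (Q2 * Q1); split=> // m.
rewrite coefD -f1 -f2 -big_split /= [Q1 * Q2]mulrC.
by apply: eq_bigr => i _; rewrite mulrDr.
Qed.

Lemma rational_seriesZ a h :
  rational_series h -> rational_series (fun k => a * h k).
Proof.
move=> [P [Q [Q0 hPQ]]]; exists (a *: P), Q; split=> // m.
rewrite coefZ -hPQ mulr_sumr; apply: eq_bigr => i _.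
by rewrite mulrCA.
Qed.

Lemma rational_series_sum (I : finType) (D : pred I) (h : I -> nat -> K) :
    (forall i, D i -> rational_series (h i)) ->
  rational_series (fun k => \sum_(i | D i) h i k).
Proof.
move=> rat_h; elim: (index_enum I) => [|i r IHr].
  exists (0 : {poly K}), (1 : {poly K}); split=> [|m]; first by rewrite coef1 oner_neq0.
  by rewrite coef0 big1 // => i _; rewrite big_nil mulr0.
have [Di | nDi] := boolP (D i); last first.
  by apply: (eq_rational_series _ IHr) => k; rewrite big_cons (negPf nDi).
apply: (eq_rational_series _ (rational_seriesD (rat_h i Di) IHr)) => k.
by rewrite big_cons Di.
Qed.

Lemma rational_series_geometric (a : K) : rational_series (fun k => a ^+ k).
Proof.
exists (1 : {poly K}), (1 - a *: 'X : {poly K}); split=> [|m].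
  by rewrite coefB coef1 coefZ coefX mulr0 subr0 oner_neq0.
rewrite coef1; case: m => [|m].
  by rewrite big_ord1 coefB coef1 coefZ coefX mulr0 subr0 mul1r.
rewrite !big_ord_recl big1 => [|i _]; rewrite !coefB !coef1 !coefZ !coefX /=.
  by rewrite mulr0 subr0 mul1r addr0 sub0r mulr1 mulNr subn0 subSS subn0 -exprS subrr.
by rewrite mulr0 subr0 mul0r.
Qed.

End RationalSeries.

Section TuplesByEntries.

Variable T : finType.
Implicit Types S : {set T}.

Definition num_tuples_onto S (k : nat) : nat :=
  #|[set A : k.-tuple T | [set x in A] == S]|.

Lemma card_tuples_in S k :
  #|[set A : k.-tuple T | [set x in A] \subset S]| = (#|S| ^ k)%N.
Proof.
pose f (g : {ffun 'I_k -> T}) := [tuple g i | i < k].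
have f_inj : injective f.
  move=> g1 g2 eq_f; apply/ffunP => i.
  by rewrite -(tnth_mktuple g1) -(tnth_mktuple g2) -/(f g1) eq_f.
rewrite -[k in RHS]card_ord -card_ffun_on -(card_imset _ f_inj).
apply: eq_card => A; rewrite inE; apply/idP/imsetP => [/subsetP AS | [g gS ->]].
  exists [ffun i => tnth A i]; last first.
    by apply: eq_from_tnth => i; rewrite tnth_mktuple ffunE.
  by apply/ffun_onP => i; rewrite ffunE AS // inE mem_tnth.
apply/subsetP => x; rewrite inE => /tnthP[i ->]; rewrite tnth_mktuple.
exact: (ffun_onP gS).
Qed.

Lemma sum_num_tuples_onto S k :
  (\sum_(U : {set T} | U \subset S) num_tuples_onto U k = #|S| ^ k)%N.
Proof.
rewrite -card_tuples_in -sum1_card.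
rewrite (partition_big (fun A : k.-tuple T => [set x in A])
                       (fun U => U \subset S)) => [|A]; last by rewrite inE.
apply: eq_bigr => U US; rewrite /num_tuples_onto -sum1_card; apply: eq_bigl => A.
by rewrite !inE; case: eqP => [->|]; rewrite ?US ?andbF.
Qed.

Lemma rational_num_tuples_onto (K : fieldType) S :
  rational_series (fun k => (num_tuples_onto S k)%:R : K).
Proof.
have [m] := ubnP #|S|; elim: m S => // m IHm S ltSm.
have rat_proper : rational_series
    (fun k => \sum_(U : {set T} | U \proper S) (num_tuples_onto U k)%:R : K).
  apply: rational_series_sum => U US; apply: IHm.
  exact: leq_trans (proper_card US) _.
(* Solve the subset count for its term at [S]: all tuples with entries in [S], minus those whose set
   of entries is a proper subset. *)
apply: (eq_rational_series _ (rational_seriesD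
  (rational_series_geometric (#|S|%:R : K)) (rational_seriesZ (-1) rat_proper))) => k.
rewrite -natrX -sum_num_tuples_onto (bigD1 S) //= natrD natr_sum mulN1r.
rewrite [X in _ + X - _](eq_bigl (fun U : {set T} => U \proper S)) ?addrK // => U.
by rewrite properEneq andbC.
Qed.

End TuplesByEntries.

Section SimilarityClasses.

Variables (F : finFieldType) (n : nat).
Implicit Types (g h : 'M[F]_n) (S : {set 'M[F]_n}).

Lemma simconjM k g h (A : k.-tuple 'M[F]_n) : g \in unitmx -> h \in unitmx ->
  simconj g (simconj h A) = simconj (g *m h) A.
Proof.
move=> Ug Uh; have Ugh : g *m h \in unitmx by rewrite unitmx_mul Ug.
apply: val_inj; rewrite /= -map_comp; apply: eq_map => M /=.
(* Multiplying both sides on the right by [g *m h] cancels every inverse. *)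
apply: (can_inj (mulmxK Ugh)); rewrite mulmxKV // !mulmxA.
by rewrite mulmxKV // mulmxKV.
Qed.

Lemma simconj1 k (A : k.-tuple 'M[F]_n) : simconj 1%:M A = A.
Proof.
apply: val_inj; rewrite /= -[RHS]map_id; apply: eq_map => M.
by rewrite invmx1 mul1mx mulmx1.
Qed.

Lemma simorbitP k (A B : k.-tuple 'M[F]_n) :
  reflect (exists2 g, g \in unitmx & B = simconj g A) (B \in simorbit A).
Proof. by apply: (iffP imsetP) => -[g Ug ->]; exists g; rewrite // inE in Ug *. Qed.

Lemma simorbit_refl k (A : k.-tuple 'M[F]_n) : A \in simorbit A.
Proof. by apply/simorbitP; exists 1%:M; rewrite ?unitmx1 ?simconj1. Qed.

Lemma simorbit_sub k (A B : k.-tuple 'M[F]_n) :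
  B \in simorbit A -> simorbit B \subset simorbit A.
Proof.
case/simorbitP => g Ug ->; apply/subsetP => C /simorbitP[h Uh ->].
by rewrite simconjM //; apply/simorbitP; exists (h *m g); rewrite // unitmx_mul Uh.
Qed.

Lemma simorbit_eq k (A B : k.-tuple 'M[F]_n) :
  (simorbit B == simorbit A) = (B \in simorbit A).
Proof.
apply/eqP/idP => [<- | BA]; first exact: simorbit_refl.
apply/eqP; rewrite eqEsubset simorbit_sub //=; apply: simorbit_sub.
case/simorbitP: BA => g Ug ->; apply/simorbitP; exists (invmx g); rewrite ?unitmx_inv //.
by rewrite simconjM ?unitmx_inv // mulVmx // simconj1.
Qed.

Lemma simconj_commuting k g (A : k.-tuple 'M[F]_n) : g \in unitmx ->
  A \in commuting_tuples F n k -> simconj g A \in commuting_tuples F n k.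
Proof.
move=> Ug; rewrite !inE => /allrelP Acomm.
rewrite allrel_mapl allrel_mapr; apply/allrelP => M N MA NA.
have /eqP MN := Acomm M N MA NA; apply/eqP.
by rewrite /comm_mx !mulmxA !mulmxKV // -(mulmxA g M) MN -(mulmxA g N) !mulmxA.
Qed.

(** The weights [#|simorbit A|%:R^-1] add up to 1 over each class. *)
Lemma num_sim_classesE k :
  (num_sim_classes F n k)%:R
    = \sum_(A in commuting_tuples F n k) #|simorbit A|%:R^-1 :> rat.
Proof.
rewrite /num_sim_classes (partition_big_imset (@simorbit F n k)) -sum1_card natr_sum.
apply: eq_bigr => O /imsetP[A commA ->].
(* Conjugation preserves commutation, so the commuting tuples with the same orbit as [A] form the
   whole orbit. *)
rewrite (eq_bigl (fun B => B \in simorbit A)) => [|B]; last first.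
  rewrite simorbit_eq andbC; case: simorbitP => //= -[g Ug ->].
  exact: simconj_commuting.
rewrite (eq_bigr (fun=> #|simorbit A|%:R^-1)) => [|B]; last first.
  by rewrite -simorbit_eq => /eqP->.
rewrite sumr_const -[LHS]/1 -[RHS]mulr_natr mulVf // pnatr_eq0 -lt0n.
by apply/card_gt0P; exists A; apply: simorbit_refl.
Qed.

(** The value 0 outside [S] makes two such maps equal exactly when the conjugations agree on [S]. *)
Definition conj_on S g : {ffun 'M[F]_n -> 'M[F]_n} :=
  [ffun M => if M \in S then g *m M *m invmx g else 0].

(** In effect, the cosets in GL_n of the pointwise centralizer of [S]. *)
Definition conj_maps S : {set {ffun 'M[F]_n -> 'M[F]_n}} :=
  [set conj_on S g | g : 'M[F]_n & g \in unitmx].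

(** A conjugate of [A] and the restriction of the conjugation to the entries of [A] determine each
    other, so order and repetition of the entries do not matter. *)
Lemma card_simorbit k (A : k.-tuple 'M[F]_n) :
  #|simorbit A| = #|conj_maps [set M in A]|.
Proof.
pose S := [set M in A].
pose app (f : {ffun 'M[F]_n -> 'M[F]_n}) := [tuple of [seq f M | M <- A]].
have app_conj g : app (conj_on S g) = simconj g A.
  by apply: val_inj; apply/eq_in_map => M MA; rewrite ffunE inE MA.
have app_inj : {in conj_maps S &, injective app}.
  move=> _ _ /imsetP[g _ ->] /imsetP[h _ ->] /(congr1 val) /eq_in_map eq_gh.
  apply/ffunP => M; have [MS | nMS] := boolP (M \in S).
    by apply: eq_gh; rewrite inE in MS.
  by rewrite !ffunE (negPf nMS).
rewrite -(card_in_imset app_inj) /conj_maps -imset_comp.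
by congr #|pred_of_set _|; apply: eq_imset => g; rewrite /= app_conj.
Qed.

(** Commutation and orbit size depend only on the set of entries, so grouping tuples by that set
    confines k to the factor [num_tuples_onto S k]. *)
Lemma num_sim_classes_by_entries k :
  (num_sim_classes F n k)%:R
    = \sum_(S : {set 'M[F]_n} | all2rel (@comm_mxb F n) (enum S))
        #|conj_maps S|%:R^-1 * (num_tuples_onto S k)%:R :> rat.
Proof.
have commE (A : k.-tuple 'M[F]_n) :
    (A \in commuting_tuples F n k)
      = all2rel (@comm_mxb F n) (enum [set M in A]).
  rewrite inE; apply/allrelP/allrelP => comm M N; have := comm M N;
    by rewrite !mem_enum !inE.
rewrite num_sim_classesE.
rewrite (partition_big (fun A : k.-tuple 'M[F]_n => [set M in A])
  (fun S => all2rel (@comm_mxb F n) (enum S))) => [|A]; last by rewrite commE.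
apply: eq_bigr => S commS.
rewrite (eq_bigl (fun A => A \in [set A : k.-tuple 'M[F]_n | [set M in A] == S])).
  rewrite (eq_bigr (fun=> #|conj_maps S|%:R^-1)) => [|A].
    by rewrite sumr_const mulr_natr.
  by rewrite inE card_simorbit => /eqP->.
move=> A; rewrite commE [RHS]inE.
by case: eqP => [->|]; rewrite ?commS ?andbF.
Qed.

(** The constant term 1 prescribed in [class_series] thus fits the general formula at k = 0. *)
Lemma num_sim_classes0 : num_sim_classes F n 0 = 1%N.
Proof.
rewrite /num_sim_classes (_ : commuting_tuples F n 0 = [set [tuple]]).
  by rewrite imset_set1 cards1.
by apply/setP => A; rewrite !inE tuple0 eqxx.
Qed.

End SimilarityClasses.

Theorem theorem1p3 (F : finFieldType) (n : nat) (hn : (0 < n)%N) :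
  rational_series (class_series F n).
Proof.
apply: (@eq_rational_series rat (fun k =>
    \sum_(S : {set 'M[F]_n} | all2rel (@comm_mxb F n) (enum S))
      #|conj_maps S|%:R^-1 * (num_tuples_onto S k)%:R)) => [k|].
  rewrite -num_sim_classes_by_entries /class_series.
  by case: eqP => [->|//]; rewrite num_sim_classes0.
apply: rational_series_sum => S _; apply: rational_seriesZ.
exact: rational_num_tuples_onto.
Qed.
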